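(* There exists $r_0\in\mathbb{N}$ such that the following holds for every integer $r\geq r_0$: every finite simple graph $G$ with average degree $\mathrm{Ad}(G)\geq r^7 2^{3r+17}$ satisfies $\vec{\chi}_{\ell}(G)\geq r$.
   Context: $\mathrm{Ad}(G)$ denotes the average degree of $G$. An orientation of a graph $G$ is a digraph with underlying graph $G$ having at most one arc between each pair of vertices. A $k$-list assignment $L$ of a digraph $D$ assigns to each vertex $v$ a finite set $L(v)$ of at least $k$ positive integers. An $L$-dicolouring is a function $\varphi$ with $\varphi(v)\in L(v)$ for all $v$ such that each colour class induces a subdigraph with no directed cycle. The dichoosability $\vec{\chi}_{\ell}(D)$ is the least $k$ such that $D$ admits an $L$-dicolouring for every $k$-list assignment $L$ of $D$; for a graph $G$, $\vec{\chi}_{\ell}(G)$ is the maximum of $\vec{\chi}_{\ell}(D)$ over all orientations $D$ of $G$. *)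

(* Defs.v *)
From HB Require Import structures.
From mathcomp Require Import all_boot all_order all_algebra.
From mathcomp Require Import finmap boolp.

Set Implicit Arguments.
Unset Strict Implicit.
Unset Printing Implicit Defensive.

Record sgraph (V : finType) := SGraph {
  edge : rel V;
  edge_sym : symmetric edge;
  edge_irrefl : irreflexive edge }.

Definition degree (V : finType) (G : sgraph V) (v : V) : nat :=
  #|[set w | edge G v w]|.

(* On the empty vertex set this is 0 / 0 = 0. *)
Definition average_degree (V : finType) (G : sgraph V) : rat :=
  ((\sum_(v : V) degree G v)%N%:R / #|V|%:R)%R.

(* Loopless, without parallel arcs; a pair of opposite arcs is allowed.  The
   arc set is a [{set V * V}] so that the digraphs on [V] form a finType. *)
Record digraph (V : finType) := Digraph {
  arcs : {set V * V};
  arcs_loopless : [forall v, (v, v) \notin arcs] }.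

HB.instance Definition _ (V : finType) := [isSub for @arcs V].
HB.instance Definition _ (V : finType) := [Finite of digraph V by <:].

Definition arc (V : finType) (D : digraph V) : rel V :=
  fun u v => (u, v) \in arcs D.

Definition is_orientation (V : finType) (G : sgraph V) (D : digraph V) : bool :=
  [forall u, forall v, edge G u v == (arc D u v || arc D v u)] &&
  [forall u, forall v, ~~ (arc D u v && arc D v u)].

Definition induced (V : finType) (D : digraph V) (A : {set V}) : rel V :=
  [rel u v | [&& u \in A, v \in A & arc D u v]].

(* [ucycle e [::]] holds, hence the condition [c != [::]]. *)
Definition has_directed_cycle (V : finType) (e : rel V) : Prop :=
  exists c : seq V, c != [::] /\ ucycle e c.

Definition list_assignment (V : finType) (k : nat) (L : V -> {fset nat}) : Prop :=
  forall v, (k <= #|` L v|)%N /\ (forall c, c \in L v -> (0 < c)%N).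

Definition dicolouring (V : finType) (D : digraph V) (L : V -> {fset nat})
    (phi : V -> nat) : Prop :=
  (forall v, phi v \in L v) /\
  (forall c : nat, ~ has_directed_cycle (induced D [set v | phi v == c])).

Definition dichoosable (V : finType) (D : digraph V) (k : nat) : Prop :=
  forall L : V -> {fset nat}, list_assignment k L ->
    exists phi : V -> nat, dicolouring D L phi.

(* Lists of size at least #|V| admit an injective choice of colours. *)
Lemma injective_choice (V : finType) (L : V -> {fset nat}) (s : seq V) :
    (forall v, size s <= #|` L v|)%N -> uniq s ->
  exists phi : V -> nat, {in s, forall v, phi v \in L v} /\ {in s &, injective phi}.
Proof.
elim: s => [|x s IHs] /= hL; first by exists (fun=> 0%N).
case/andP=> xs us; have [|phi [phiL phiI]] := IHs _ us.
  by move=> v; apply: leq_trans (hL v).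
have [c cL cs] : exists2 c, c \in L x & c \notin map phi s.
  have /hasP[c cL cs] : has [predC map phi s] (L x).
    rewrite -[has _ _]negbK -all_predC; apply/negP => /allP hs.
    have /(uniq_leq_size (fset_uniq (L x))) : {subset L x <= map phi s}.
      by move=> c /hs /=; rewrite negbK.
    by rewrite size_map leqNgt (hL x).
  by exists c.
have neq v : v \in s -> v == x = false.
  by move=> vs; apply/eqP => vx; rewrite -vx vs in xs.
have ncs v : v \in s -> phi v <> c.
  by move=> vs pc; case/negP: cs; rewrite -pc map_f.
exists (fun v => if v == x then c else phi v); split.
  move=> v; rewrite inE; case: eqVneq => [-> //|_ /=]; exact: phiL.
move=> u v; rewrite !inE.
case: (eqVneq u x) => [->|_] /=; case: (eqVneq v x) => [->|_] //=.
- by move=> _ vs /esym /ncs -/(_ vs).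
- by move=> us' _ /ncs -/(_ us').
- exact: phiI.
Qed.

Lemma exists_dichoosable (V : finType) (D : digraph V) :
  exists k, `[< dichoosable D k >].
Proof.
exists #|V|; apply/asboolP => L hL.
have [|phi [phiL phiI]] := @injective_choice V L (enum V) _ (enum_uniq V).
  by move=> v; rewrite -cardE; case: (hL v).
exists phi; split=> [v|c [p [p0 /andP[hc hu]]]].
  by apply: phiL; rewrite mem_enum.
case: p p0 hc hu => // x [|y p] _ /=.
  by rewrite andbT => /and3P[_ _]; rewrite /arc (negPf (forallP (arcs_loopless D) x)).
case/andP=> /and3P[]; rewrite !inE => /eqP xc /eqP yc _ _.
have -> : x = y by apply: phiI; rewrite ?mem_enum // xc yc.
by rewrite eqxx.
Qed.

Definition dichoosability (V : finType) (D : digraph V) : nat :=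
  ex_minn (exists_dichoosable D).

Definition graph_dichoosability (V : finType) (G : sgraph V) : nat :=
  \max_(D : digraph V | is_orientation G D) dichoosability D.

(* Main.v *)
(* Write k = r - 1, and let every list be a k-subset of a palette of 6k colours.
   As in Alon's lower bound on the choice number, pass to a subgraph of large
   minimum degree and draw a sparse random vertex set B together with random
   lists on B; most vertices outside B then see, for each half of the palette,
   many vertices of B whose lists lie in that half.  Hence, however B is
   coloured from its lists, at least half of the colours occur often around such
   a vertex.  Random lists outside B make, for all colourings of B at once, at
   least |B| vertices have only such colours in their lists, so that every
   colouring has a large number of monochromatic edges between B and these
   vertices.  Finally, an acyclic orientation is determined by its out-degree
   sequence, so a graph has at most prod (deg v + 1) acyclic orientations; this is
   small enough for a random orientation to create a monochromatic directed cycle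
   in every colouring simultaneously. *)
Require Import Defs.
From mathcomp Require Import all_boot all_order all_algebra.
From mathcomp Require Import finmap boolp zify.

Set Implicit Arguments.
Unset Strict Implicit.
Unset Printing Implicit Defensive.

(** * Acyclic orientations *)

(** Iterating a successor function from [x] must eventually repeat a vertex; the stretch between the
    two visits is a simple cycle. *)
Lemma has_directed_cycle_succ (V : finType) (e : rel V) (X : {set V}) (x : V) :
    x \in X -> (forall v, v \in X -> exists2 w, w \in X & e v w) ->
  has_directed_cycle e.
Proof.
move=> xX succ; pose f v := odflt v [pick w in X | e v w].
have fP v : v \in X -> (f v \in X) && e v (f v).
  move=> vX; rewrite /f; case: pickP => [w //|no].
  by have [w wX evw] := succ v vX; have := no w; rewrite /= wX evw.
have fX n : iter n f x \in X by elim: n => //= n /fP /andP[].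
have pathX m v : v \in X -> path e v (traject f (f v) m).
  by elim: m v => //= m IHm v /fP /andP[fvX ->]; apply: IHm.
have /trajectP[i lti Ei] := looping_order f x.
(* The orbit of [x] re-enters itself at its [i]-th point, so the cycle is what remains after the
   first [i] points. *)
have Em : fingraph.order f x = i + (fingraph.order f x - i).-1.+1 by lia.
set m := (_ - i).-1 in Em.
exists (traject f (iter i f x) m.+1); split=> //; apply/andP; split.
  rewrite trajectS /= -[X in rcons _ X]Ei Em addnC iterD iterSr -trajectSr.
  exact: pathX.
have := orbit_uniq f x; rewrite /orbit Em trajectD cat_uniq.
by case/and3P.
Qed.

(* [F] is a set of reference arcs and [w] selects the ones kept; the arcs of [F]
   outside [w] are reversed. *)
Definition reorient (V : finType) (F w : {set V * V}) : rel V :=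
  fun u v => ((u, v) \in F :&: w) || ((v, u) \in F :\: w).

Definition pair_degree (V : finType) (F : {set V * V}) (v : V) : nat :=
  #|[set x | ((v, x) \in F) || ((x, v) \in F)]|.

(* The arcs on which the two orientations differ are balanced at every vertex, so
   they would contain a directed cycle. *)
Lemma acyclic_reorient_inj (V : finType) (F w w' : {set V * V}) :
    (forall u v, (u, v) \in F -> (v, u) \notin F) ->
    ~ has_directed_cycle (reorient F w) ->
    (forall v, #|[set x | reorient F w v x]| = #|[set x | reorient F w' v x]|) ->
  F :&: w = F :&: w'.
Proof.
move=> antiF acyc eqdeg.
have asymF u v : ~~ (((u, v) \in F) && ((v, u) \in F)).
  by apply/negP => /andP[/antiF/negP].
pose Delta u v := reorient F w u v && reorient F w' v u.
have balanced v : #|[set x | Delta v x]| = #|[set x | Delta x v]|.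
  pose A := [set x | reorient F w v x]; pose B := [set x | reorient F w' v x].
  have EA : A :\: B = [set x | Delta v x].
    apply/setP=> x; rewrite !inE /Delta /reorient !inE.
    by have := asymF v x; do !case: (_ \in _).
  have EB : B :\: A = [set x | Delta x v].
    apply/setP=> x; rewrite !inE /Delta /reorient !inE.
    by have := asymF v x; do !case: (_ \in _).
  have := cardsID B A; have := cardsID A B; rewrite EA EB setIC -/A.
  have := eqdeg v; rewrite -/A -/B; lia.
have noDelta u v : ~~ Delta u v.
  apply/negP => Duv; apply: acyc.
  (* The head of a [Delta] arc has an incoming, hence by balance an outgoing, [Delta] arc. *)
  apply: (@has_directed_cycle_succ _ _ [set z | [exists t, Delta z t]] u).
    by rewrite inE; apply/existsP; exists v.
  move=> z; rewrite inE => /existsP[t Dzt]; exists t; last by case/andP: Dzt.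
  have : 0 < #|[set x | Delta t x]|.
    by rewrite balanced; apply/card_gt0P; exists z; rewrite inE.
  case/card_gt0P=> x; rewrite inE => Dtx; rewrite inE.
  by apply/existsP; exists x.
apply/setP=> -[u v]; have := noDelta u v; have := noDelta v u.
have := asymF u v; rewrite /Delta /reorient !inE.
by do !case: (_ \in _).
Qed.

(** An acyclic [w] is recovered from its part outside [F], which is free, and from its out-degrees,
    each at most the degree in [F]. *)
Lemma card_acyclic_reorient (V : finType) (F : {set V * V}) :
    (forall u v, (u, v) \in F -> (v, u) \notin F) ->
  #|[set w | `[< ~ has_directed_cycle (reorient F w) >]]| * 2 ^ #|F|
    <= 2 ^ #|{: V * V}| * \prod_(v : V) (pair_degree F v).+1.
Proof.
move=> antiF; set A := [set w | _].
pose outdeg w : {ffun V -> 'I_#|V|.+1} :=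
  [ffun v => inord #|[set x | reorient F w v x]|].
have outdegE w v : outdeg w v = #|[set x | reorient F w v x]| :> nat.
  by rewrite ffunE inordK // ltnS max_card.
pose P v := [pred i : 'I_#|V|.+1 | i <= pair_degree F v].
have cardP v : #|P v| = (pair_degree F v).+1.
  have le : pair_degree F v < #|V|.+1 by rewrite ltnS max_card.
  rewrite -[RHS]card_ord -(card_image (f := widen_ord le)); last first.
    by move=> i j /(congr1 val) /= /val_inj.
  apply: eq_card => i; rewrite !inE; apply/idP/imageP => [lei|[j _ ->]].
    by exists (Ordinal (lei : i < (pair_degree F v).+1)); last exact: val_inj.
  by rewrite -ltnS /= ltn_ord.
have le : #|A| <= 2 ^ #|~: F| * \prod_(v : V) (pair_degree F v).+1.
  have -> : 2 ^ #|~: F| * \prod_(v : V) (pair_degree F v).+1 =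
      #|setX (powerset (~: F)) [set h in family P]|.
    rewrite cardsX card_powerset; congr (_ * _).
    under eq_bigr => v _ do rewrite -cardP -sum1_card.
    rewrite bigA_distr_big_dep -sum1_card.
    apply: eq_big => [h|h _]; last by rewrite big1_eq.
    by rewrite inE; apply/familyP/familyP => hP v; have := hP v; rewrite !inE.
  pose f w := (w :\: F, outdeg w).
  have injf : {in A &, injective f}.
    move=> w w' /[!inE] /asboolP acyc _ [ED Eo].
    have EI : F :&: w = F :&: w'.
      by apply: acyclic_reorient_inj => // v; rewrite -!outdegE Eo.
    by rewrite -(setID w F) -(setID w' F) ED ![_ :&: F]setIC EI.
  rewrite -(card_in_imset injf); apply: subset_leq_card.
  apply/subsetP => _ /imsetP[w _ ->]; rewrite in_setX; apply/andP; split.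
    by rewrite powersetE setDE subsetIr.
  rewrite inE; apply/familyP => v; rewrite !inE outdegE; apply: subset_leq_card.
  apply/subsetP => x; rewrite !inE => /orP[] /[!inE] /andP[].
    by move=> ->.
  by move=> _ ->; rewrite orbT.
apply: leq_trans (leq_mul le (leqnn _)) _.
by rewrite mulnAC -expnD addnC cardsC.
Qed.

(** Applied at each vertex of [W], this bounds the product of the deg + 1 by 2^(|F|/2 + 3|W|/2),
    since the degrees sum to at most 2|F|. *)
Lemma expn4_succ_le (x : nat) : x.+1 ^ 4 <= 2 ^ (x + 6).
Proof.
have [|lt4x] := leqP x 4; first by do 5 case: x => [|x] //.
rewrite -(subnK lt4x); elim: (x - 5) => // y IHy.
rewrite (addSn y) (addSn (y + 5)) [2 ^ _.+1]expnS.
apply: leq_trans (leq_mul (leqnn 2) IHy).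
set z := y + 5; have : 5 <= z by rewrite leq_addl.
move: z => z; rewrite !expnS expn0; nia.
Qed.

Lemma sum_pair_degree (V : finType) (F : {set V * V}) :
  \sum_(v : V) pair_degree F v <= 2 * #|F|.
Proof.
have le v : pair_degree F v <=
    \sum_(x : V) ((v, x) \in F) + \sum_(x : V) ((x, v) \in F).
  rewrite -big_split /= /pair_degree -sum1_card big_mkcond /=.
  by apply: leq_sum => x _; rewrite inE; do 2 case: (_ \in _).
apply: leq_trans; first by apply: leq_sum => v _; exact: le.
rewrite big_split /= [X in _ + X <= _]exchange_big /= addnn -mul2n leq_mul2l /=.
rewrite pair_big /= -sum1_card [leqRHS]big_mkcond /=.
by apply: leq_sum => -[u v] _ /=; case: (_ \in _).
Qed.

(** A uniform [w] is acyclic on [F] with probability at most 2^-x: the hypothesis on [#|F|] amounts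
    to 2|F| + 6|W| <= 4(|F| - x), where the left side is the exponent bounding the fourth power of
    the degree product. *)
Lemma acyclic_reorient_rare (V : finType) (F : {set V * V}) (W : {set V}) (x : nat) :
    (forall u v, (u, v) \in F -> [/\ (v, u) \notin F, u \in W & v \in W]) ->
    3 * #|W| + 2 * x <= #|F| ->
  #|[set w | `[< ~ has_directed_cycle (reorient F w) >]]| * 2 ^ x
    <= #|{set V * V}|.
Proof.
move=> FP le; have -> : #|{set V * V}| = 2 ^ #|{: V * V}|.
  by rewrite -cardsT -powersetT card_powerset cardsT.
have pos : 0 < 2 ^ #|F| by rewrite expn_gt0.
rewrite -(leq_pmul2r pos) mulnAC.
have antiF u v : (u, v) \in F -> (v, u) \notin F by case/FP.
apply: leq_trans (leq_mul (card_acyclic_reorient antiF) (leqnn _)) _.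
rewrite -mulnA leq_mul2l; apply/orP; right.
have : (\prod_(v : V) (pair_degree F v).+1) ^ 4 <= 2 ^ (4 * (#|F| - x)).
  have -> : \prod_(v : V) (pair_degree F v).+1 =
      \prod_(v in W) (pair_degree F v).+1.
    rewrite (bigID (mem W)) /= [X in _ * X]big1 ?muln1 // => v vW.
    rewrite /pair_degree; apply/eqP; rewrite eqSS cards_eq0 -subset0.
    apply/subsetP => y; rewrite !inE.
    by case/orP => /FP[_]; rewrite (negPf vW).
  rewrite (big_morph (fun n => n ^ 4) (fun a b => expnMn a b 4) (exp1n 4)).
  apply: leq_trans; first by apply: leq_prod => v _; exact: expn4_succ_le.
  rewrite -expn_sum leq_exp2l // big_split /= sum_nat_const.
  have : \sum_(v in W) pair_degree F v <= 2 * #|F|.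
    apply: leq_trans (sum_pair_degree F).
    by rewrite [leqRHS](bigID (mem W)) /= leq_addr.
  by move: le; set m := \sum_(v in W) _; move: m #|F| #|W| => m f n; lia.
rewrite [4 * _]mulnC expnM leq_exp2r // => le'.
apply: leq_trans (leq_mul le' (leqnn _)) _.
by rewrite -expnD subnK //; lia.
Qed.

(** * Counting random choices *)

(** With Y = z + 1 this is (1 - 1/Y)^Y <= 1/2; it follows from the first two terms of a binomial
    expansion. *)
Lemma double_pred_expn_le (z : nat) : 2 * z ^ z.+1 <= z.+1 ^ z.+1.
Proof.
suff le m : z ^ m.+1 + m.+1 * z ^ m <= z.+1 ^ m.+1.
  have := le z; rewrite [z ^ z.+1]expnS; nia.
elim: m => [|m IHm]; first by rewrite !expn1 expn0 muln1 addn1.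
rewrite [z.+1 ^ m.+2]expnS; apply: leq_trans (leq_mul (leqnn _) IHm).
rewrite !expnS; nia.
Qed.

(* The exponential moment [E 2^-X] of the number of hits [X], cleared of
   denominators: a hit weighs 1 and a miss weighs 2. *)
Lemma lower_tail (I J : finType) (S : {set I}) (P : I -> pred J) (y s u : nat) :
    0 < y -> (forall i, i \in S -> #|J| <= y * #|P i|) ->
    2 * y * (s + u) <= #|S| ->
  #|[set f : {ffun I -> J} | #|[set i in S | P i (f i)]| < s]| * 2 ^ u
    <= #|J| ^ #|I|.
Proof.
move=> y0 hP hS; set A := [set f | _].
pose wt i j := if i \in S then (~~ P i j).+1 else 1.
pose Y := 2 * y; pose n := #|S|.
have prodS (c : nat) : \prod_(i : I) (if i \in S then c else 1) = c ^ n.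
  by rewrite -big_mkcond prod_nat_const.
(* Markov's inequality: a function with fewer than [s] hits has weight at least 2^(n - s). *)
have lowA : #|A| * 2 ^ n <= 2 ^ s * \sum_(f : {ffun I -> J}) \prod_(i : I) wt i (f i).
  rewrite -sum_nat_const big_distrr /= [leqRHS](bigID (mem A)) /=.
  apply: leq_trans (leq_addr _ _); apply: leq_sum => f; rewrite inE => /ltnW ltX.
  set X := #|_| in ltX; apply: leq_trans (leq_mul (leq_pexp2l _ ltX) (leqnn _)) => //.
  have -> : 2 ^ X = \prod_(i : I) (if (i \in S) && P i (f i) then 2 else 1).
    rewrite -big_mkcond -[X]cardsE prod_nat_const; congr (_ ^ _).
    by apply: eq_card => i; rewrite !inE.
  rewrite -prodS -big_split /=; apply: leq_prod => i _.
  by rewrite /wt; case: (i \in S); case: (P i (f i)).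
(* The total weight factors over coordinates; one in [S] contributes 2|J| - |P i|, which is at most
   2|J|(1 - 1/Y). *)
have upA : Y ^ n * \sum_(f : {ffun I -> J}) \prod_(i : I) wt i (f i) <=
    #|J| ^ #|I| * (2 * Y.-1) ^ n.
  have -> : #|J| ^ #|I| = \prod_(i : I) #|J| by rewrite prod_nat_const.
  rewrite -(bigA_distr_bigA wt) -!prodS -!big_split /=.
  apply: leq_prod => i _; rewrite /wt; case: (boolP (i \in S)) => iS; last first.
    by rewrite sum_nat_const mul1n.
  have EP : \sum_j (~~ P i j).+1 + #|P i| = 2 * #|J|.
    rewrite -sum1_card (big_mkcond (fun j => j \in P i)) -big_split /=.
    have -> : 2 * #|J| = \sum_(j : J) 2 by rewrite sum_nat_const mulnC.
    apply: eq_bigr => j _.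
    by rewrite unfold_in; case: (P i j).
  have -> : #|J| * (2 * Y.-1) = 2 * Y * #|J| - 2 * #|J|.
    by rewrite -subn1 mulnBr muln1 mulnBr; lia.
  have E : Y * \sum_j (~~ P i j).+1 + 2 * (y * #|P i|) = 2 * Y * #|J|.
    have -> : 2 * (y * #|P i|) = Y * #|P i| by rewrite /Y; lia.
    by rewrite -mulnDr EP; lia.
  have := hP i iS; move: E; set a := Y * _; set b := y * _; lia.
(* Since n >= Y(s + u), the bound (1 - 1/Y)^Y <= 1/2 applies s + u times. *)
have pow : Y.-1 ^ n * 2 ^ (s + u) <= Y ^ n.
  have Y1 : Y = Y.-1.+1 by rewrite /Y; lia.
  have mono a b e : a <= b -> a ^ e <= b ^ e.
    by case: e => // e; rewrite leq_exp2r.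
  rewrite -(subnKC (hS : Y * (s + u) <= n)); set t := _ - _.
  rewrite !(expnD _ _ t) mulnAC leq_mul //; last first.
    by rewrite mono ?leq_pred.
  rewrite !(expnM _ Y) -expnMn mono //.
  by have := double_pred_expn_le Y.-1; rewrite -Y1 mulnC.
have pos : 0 < 2 ^ n * Y ^ n by rewrite muln_gt0 !expn_gt0 /Y muln_gt0 y0.
rewrite -(leq_pmul2r pos).
have -> : #|A| * 2 ^ u * (2 ^ n * Y ^ n) = #|A| * 2 ^ n * (2 ^ u * Y ^ n) by lia.
apply: leq_trans (leq_mul lowA (leqnn _)) _; set m := \sum_f _ in upA *.
have -> : 2 ^ s * m * (2 ^ u * Y ^ n) = Y ^ n * m * 2 ^ (s + u).
  by rewrite expnD; lia.
apply: leq_trans (leq_mul upA (leqnn _)) _.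
by rewrite expnMn -!mulnA leq_mul2l leq_mul2l pow !orbT.
Qed.

Lemma union_bound (I T : finType) (P : pred I) (A : I -> {set T}) (a x : nat) :
    #|P| <= 2 ^ a -> (forall i, P i -> #|A i| * 2 ^ (a + x) <= #|T|) ->
  #|\bigcup_(i | P i) A i| * 2 ^ x <= #|T|.
Proof.
move=> leP hA; have le : #|\bigcup_(i | P i) A i| <= \sum_(i | P i) #|A i|.
  elim/big_rec2: _ => [|i m B _ le]; first by rewrite cards0.
  by apply: leq_trans (leq_add (leqnn _) le); rewrite leq_card_setU.
have pos : 0 < 2 ^ a by rewrite expn_gt0.
rewrite -(leq_pmul2l pos) mulnCA -expnD.
apply: leq_trans (leq_mul le (leqnn _)) _; rewrite big_distrl /=.
apply: leq_trans; first by apply: leq_sum => i; exact: hA.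
by rewrite sum_nat_const leq_mul2r leP orbT.
Qed.

Lemma exists_notin_half (T : finType) (A : {set T}) :
  0 < #|T| -> #|A| * 2 <= #|T| -> exists x, x \notin A.
Proof.
move=> T0 le; have : 0 < #|~: A| by have := cardsC A; lia.
by case/card_gt0P=> x; rewrite inE; exists x.
Qed.

(** * Vertices that see many lists *)

(* A set [U] maximising [e(U) + 2 d |V \ U|], where [e] counts ordered edges,
   cannot lose a vertex of degree less than [d]. *)
Lemma min_degree_subset (V : finType) (G : sgraph V) (d : nat) :
    0 < #|V| -> 2 * d * #|V| <= \sum_(v : V) degree G v ->
  exists2 U : {set V}, U != set0 &
    forall v, v \in U -> d <= #|[set w in U | edge G v w]|.
Proof.
move=> V0 hd; pose e (U : {set V}) := \sum_(u in U) \sum_(w in U) edge G u w.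
have cardE (U : {set V}) v : #|[set w in U | edge G v w]| = \sum_(w in U) edge G v w.
  rewrite -sum1_card big_mkcond [RHS]big_mkcond /=; apply: eq_bigr => w _.
  by rewrite inE; case: (w \in U); case: (edge G v w).
have eD1 (U : {set V}) v : v \in U ->
    e U = e (U :\ v) + 2 * #|[set w in U | edge G v w]|.
  move=> vU; have E u : \sum_(w in U) edge G u w =
      edge G u v + \sum_(w in U :\ v) edge G u w by rewrite (big_setD1 v).
  rewrite /e (big_setD1 v) //= (eq_bigr _ (fun u _ => E u)) big_split /= cardE E.
  under [X in _ + (X + _)]eq_bigr do rewrite edge_sym.
  by rewrite edge_irrefl !add0n addnA addnn -mul2n addnC.
pose pot U := e U + 2 * d * #|~: U|.
have T0 : [set: V] != set0 by rewrite -card_gt0 cardsT.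
have [U U0 Umax] := @arg_maxnP _ [set: V] (fun A => A != set0) pot T0.
have potT : 2 * d * #|V| <= pot [set: V].
  apply: leq_trans hd _; rewrite /pot; apply: leq_trans (leq_addr _ _).
  rewrite /e; under [leqRHS]eq_bigl do rewrite inE.
  apply: leq_sum => v _; rewrite -cardE; apply: subset_leq_card.
  by apply/subsetP => w; rewrite !inE.
exists U => // v vU; have : pot (U :\ v) <= pot U.
  (* The maximum ranges over non-empty sets only; the empty set has potential 2d|V|, which the full
     set already reaches. *)
  have [E|] := eqVneq (U :\ v) set0; last exact: Umax.
  apply: leq_trans (Umax _ T0); apply: leq_trans potT.
  by rewrite E /pot /e big_set0 setC0 cardsT.
have E : #|~: (U :\ v)| = #|~: U|.+1.
  by rewrite setCD setUC cardsU1 inE vU.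
by rewrite /pot (eD1 _ _ vU) E; nia.
Qed.

Lemma card_ffun_at (I J : finType) (i : I) (P : pred J) :
  #|[set f : {ffun I -> J} | P (f i)]| * #|J| = #|P| * #|J| ^ #|I|.
Proof.
pose wt x j : nat := if x == i then P j : nat else 1.
have -> : #|[set f : {ffun I -> J} | P (f i)]| =
    \sum_(f : {ffun I -> J}) \prod_(x : I) wt x (f x).
  rewrite -sum1_card big_mkcond /=; apply: eq_bigr => f _.
  rewrite inE (bigD1 i) //= big1 => [|x /negPf xi]; last by rewrite /wt xi.
  by rewrite muln1 /wt eqxx; case: (P _).
have -> : #|J| ^ #|I| = \prod_(x : I) #|J| by rewrite prod_nat_const.
rewrite -(bigA_distr_bigA wt) (bigD1 i) //= [in RHS](bigD1 i) //= -mulnA.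
rewrite [X in _ * X]mulnC; congr (_ * (_ * _)).
  rewrite -sum1_card [RHS]big_mkcond. apply: eq_bigr => j _.
  by rewrite /wt eqxx unfold_in; case: (P j).
apply: eq_bigr => x /negPf xi; rewrite /wt xi.
by rewrite sum_nat_const muln1.
Qed.

Lemma sum_card_exchange (I T : finType) (U : {set I}) (R : T -> pred I) :
  \sum_(f : T) #|[set v in U | R f v]| = \sum_(v in U) #|[set f | R f v]|.
Proof.
transitivity (\sum_(f : T) \sum_(v in U) R f v).
  apply: eq_bigr => f _; rewrite -sum1_card big_mkcond [RHS]big_mkcond /=.
  by apply: eq_bigr => v _; rewrite inE; case: (v \in U); case: (R f v).
rewrite exchange_big; apply: eq_bigr => v _.
rewrite -sum1_card [RHS]big_mkcond; apply: eq_bigr => f _.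
by rewrite inE; case: (R f v).
Qed.

Definition draw (C : finType) (k : nat) := {X : {set C} | #|X| == k}.

Lemma card_draw_sub (C : finType) (k : nat) (Q : {set C}) :
  #|[pred X : draw C k | val X \subset Q]| = 'C(#|Q|, k).
Proof.
rewrite -cards_draws -(card_imset _ val_inj) /=; apply: eq_card => X.
apply/imsetP/idP => [[Y] |]; rewrite inE.
  by move=> YQ ->; rewrite (valP Y) andbT.
by case/andP => XQ Xk; exists (Sub X Xk); rewrite ?inE SubK.
Qed.

Lemma card_draw (C : finType) (k : nat) : #|{: draw C k}| = 'C(#|C|, k).
Proof.
rewrite -[#|C|]cardsT -card_draw_sub; apply: eq_card => X.
by rewrite !inE subsetT.
Qed.

Lemma exists_subset_card (T : finType) (A : {set T}) (n : nat) :
  n <= #|A| -> exists2 Q : {set T}, Q \subset A & #|Q| = n.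
Proof.
rewrite -bin_gt0 -cards_draws => /card_gt0P[Q].
by rewrite inE => /andP[QA /eqP Qn]; exists Q.
Qed.

Definition frequent (V C : finType) (G : sgraph V) (B : {set V}) (m : nat)
    (phi : V -> C) (v : V) : {set C} :=
  [set c | m <= #|[set b in B | edge G v b && (phi b == c)]|].

(** This speaks of lists only, so one random choice of lists serves every colouring of [B]. *)
Definition rich (V C : finType) (G : sgraph V) (k h s : nat) (B : {set V})
    (L : V -> draw C k) (v : V) : bool :=
  [forall Q : {set C}, (#|Q| == h) ==>
    (s <= #|[set b in B | edge G v b && (val (L b) \subset Q)]|)].

(* If half of the colours were infrequent, the many lists inside that half would
   force one of them to be frequent. *)
Lemma rich_frequent (V C : finType) (G : sgraph V) (k h m : nat) (B : {set V})
    (L : V -> draw C k) (v : V) (phi : V -> C) :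
    #|C| = 2 * h -> 0 < h * m -> rich G h (h * m) B L v ->
    (forall b, b \in B -> phi b \in val (L b)) ->
  h <= #|frequent G B m phi v|.
Proof.
move=> cardC hm0 /forallP richv phiL; rewrite leqNgt; apply/negP => lt.
have [|Q QF Qh] := @exists_subset_card _ (~: frequent G B m phi v) h.
  by have := cardsC (frequent G B m phi v); rewrite cardC; lia.
have /implyP := richv Q; rewrite Qh eqxx => /(_ isT); apply/negP; rewrite -ltnNge.
have sub : [set b in B | edge G v b && (val (L b) \subset Q)] \subset
    \bigcup_(c in Q) [set b in B | edge G v b && (phi b == c)].
  apply/subsetP => b; rewrite inE => /and3P[bB vb /subsetP LQ].
  by apply/bigcupP; exists (phi b); [exact: LQ (phiL _ bB) | rewrite inE bB vb /=].
apply: leq_ltn_trans (subset_leq_card sub) _.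
apply: (@leq_ltn_trans (\sum_(c in Q) m.-1)).
  apply: (@leq_trans (\sum_(c in Q) #|[set b in B | edge G v b && (phi b == c)]|)).
    elim/big_rec2: _ => [|c n X _ le]; first by rewrite cards0.
    by apply: leq_trans (leq_add (leqnn _) le); rewrite leq_card_setU.
  apply: leq_sum => c /(subsetP QF); rewrite !inE -ltnNge; lia.
rewrite sum_nat_const Qh; nia.
Qed.

(** Each vertex draws a number below [N] and a list, and joins [B] when the number is 0. A neighbour
    then lies in [B] with its list inside a given half with probability at least 1/(NT). A single
    expectation controls the poor vertices and |B| together. *)
Lemma exists_rich_sample (V C : finType) (G : sgraph V) (U : {set V})
    (k h s N T : nat) :
    #|C| = 2 * h -> 0 < T -> 0 < N -> k <= h -> 'C(2 * h, k) <= T * 'C(h, k) ->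
    (forall v, v \in U ->
      2 * (N * T) * (s + (2 * h + 3)) <= #|[set w in U | edge G v w]|) ->
  exists (B : {set V}) (L : V -> draw C k), B \subset U /\
    8 * #|[set v in U | ~~ rich G h s B L v]| + N * #|B| <= 2 * #|U|.
Proof.
move=> cardC T0 N0 kh hT degU; case: N N0 degU => // N _ degU.
pose J := ('I_N.+1 * draw C k)%type.
have cardJ : #|{: J}| = N.+1 * 'C(2 * h, k).
  by rewrite card_prod card_ord card_draw cardC.
have J0 : 0 < #|{: J}| by rewrite cardJ muln_gt0 bin_gt0; lia.
pose total := #|{ffun V -> J}|.
have totalE : total = #|{: J}| ^ #|V| by rewrite /total card_ffun.
have total0 : 0 < total by rewrite totalE expn_gt0 J0.
pose BB (f : {ffun V -> J}) := [set v in U | (f v).1 == ord0].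
pose LL (f : {ffun V -> J}) v := (f v).2.
pose poor f v := ~~ rich G h s (BB f) (LL f) v.
suff [f hf] : exists f, 8 * #|[set v in U | poor f v]| + N.+1 * #|BB f| <= 2 * #|U|.
  exists (BB f), (LL f); split=> //.
  by apply/subsetP => v; rewrite inE => /andP[].
have poorE v : v \in U -> #|[set f | poor f v]| * 2 ^ 3 <= total.
  move=> vU.
  pose hit (Q : {set C}) (i : V) (j : J) := (j.1 == ord0) && (val j.2 \subset Q).
  pose few (Q : {set C}) := [set f : {ffun V -> J} |
    #|[set i in [set w in U | edge G v w] | hit Q i (f i)]| < s].
  have sub : [set f | poor f v] \subset \bigcup_(Q : {set C} | #|Q| == h) few Q.
    apply/subsetP => f; rewrite inE /poor /rich negb_forall => /existsP[Q].
    rewrite negb_imply -ltnNge => /andP[Qh lts]; apply/bigcupP; exists Q => //.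
    rewrite inE; apply: leq_ltn_trans lts; apply: subset_leq_card.
    apply/subsetP => b; rewrite !inE /hit /=.
    by case/andP => /andP[-> ->] /andP[-> ->].
  apply: leq_trans (leq_mul (subset_leq_card sub) (leqnn _)) _.
  (* The exponent 2h pays for the at most 2^(2h) sets [Q]; the remaining 3 leaves a vertex poor with
     probability at most 1/8. *)
  apply: (@union_bound _ _ _ _ (2 * h)).
    apply: leq_trans (max_card _) _.
    by rewrite -cardsT -powersetT card_powerset cardsT cardC.
  move=> Q /eqP Qh; rewrite card_ffun; apply: (@lower_tail _ _ _ _ (N.+1 * T)).
  - by rewrite muln_gt0.
  - move=> i _; have -> : #|hit Q i| = 'C(h, k).
      rewrite -Qh -card_draw_sub -[RHS]mul1n -(card1 (@ord0 N)) -cardX.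
      by apply: eq_card => -[j1 j2]; rewrite !inE.
    by rewrite cardJ -mulnA leq_mul2l hT orbT.
  - exact: degU.
have BBE v : v \in U -> N.+1 * #|[set f : {ffun V -> J} | (f v).1 == ord0]| <= total.
  move=> vU; have := @card_ffun_at V J v (fun j : J => j.1 == ord0).
  have -> : #|fun j : J => j.1 == ord0| = 'C(2 * h, k).
    rewrite -cardC -card_draw -[RHS]mul1n -(card1 (@ord0 N)) -cardX.
    by apply: eq_card => -[j1 j2]; rewrite !inE andbT.
  have b0 : 0 < 'C(2 * h, k) by rewrite bin_gt0; lia.
  rewrite -totalE cardJ mulnA => /eqP; rewrite [X in X == _]mulnC eqn_pmul2l //.
  by rewrite mulnC => /eqP ->.
have sum_le : \sum_(f : {ffun V -> J})
    (8 * #|[set v in U | poor f v]| + N.+1 * #|BB f|) <= 2 * #|U| * total.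
  rewrite big_split /= -!big_distrr /= !sum_card_exchange !big_distrr /= -big_split /=.
  rewrite -mulnA mulnCA -sum_nat_const; apply: leq_sum => v vU.
  rewrite mul2n -addnn leq_add ?BBE //.
  by rewrite mulnC; exact: poorE.
apply: contrapT => /forallNP noF; move: sum_le; apply/negP; rewrite -ltnNge.
apply: (@leq_trans (\sum_(f : {ffun V -> J}) (2 * #|U|).+1)).
  by rewrite sum_nat_const -/total mulnC ltn_pmul2l.
by apply: leq_sum => f _; rewrite ltnNge; apply/negP/noF.
Qed.

(** For a fixed colouring of [B], each list on [S] falls into the frequent colours with probability
    at least 1/T, so fewer than |B| successes have probability at most 2^-(l|B| + 1). This survives
    a union over at most 2^(l|B|) colourings. *)
Lemma exists_frequent_lists (V C : finType) (G : sgraph V) (c0 : C) (k h l m T : nat)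
    (B S : {set V}) (L : V -> draw C k) :
    0 < T -> k <= h -> #|C| = 2 * h -> 'C(2 * h, k) <= T * 'C(h, k) -> #|C| <= 2 ^ l ->
    0 < h * m -> (forall v, v \in S -> rich G h (h * m) B L v) ->
    2 * T * (#|B| + (l * #|B| + 1)) <= #|S| ->
  exists g : {ffun V -> draw C k}, forall phi, phi \in pffun_on c0 B predT ->
    (forall b, b \in B -> phi b \in val (L b)) ->
    #|B| <= #|[set a in S | val (g a) \subset frequent G B m phi a]|.
Proof.
move=> T0 kh cardC hT hl hm0 richS leS.
(* A colouring of [B] is padded with [c0] outside [B], so that there are only |C|^|B| of them. *)
pose fits phi := (phi \in pffun_on c0 B predT) &&
  [forall b in B, phi b \in val (L b)].
pose few phi := [set g : {ffun V -> draw C k} |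
  #|[set a in S | val (g a) \subset frequent G B m phi a]| < #|B|].
have le : #|\bigcup_(phi | fits phi) few phi| * 2 <= #|{ffun V -> draw C k}|.
  apply: (@union_bound _ _ _ _ (l * #|B|) 1).
    apply: (@leq_trans #|pffun_on c0 B predT|).
      by apply: subset_leq_card; apply/subsetP => phi /andP[].
    rewrite card_pffun_on expnM; case: #|B| => // n.
    by rewrite leq_exp2r.
  move=> phi /andP[_ /forall_inP phiL]; rewrite card_ffun.
  apply: (@lower_tail _ _ S (fun a (X : draw C k) =>
    val X \subset frequent G B m phi a) T) => //.
  move=> a aS; rewrite card_draw card_draw_sub cardC.
  apply: leq_trans hT _; rewrite leq_mul2l; apply/orP; right.
  by apply: leq_bin2l; apply: rich_frequent (richS a aS) phiL.
have [|g gP] := exists_notin_half _ le.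
  by rewrite card_ffun expn_gt0 card_draw cardC bin_gt0; lia.
exists g => phi phiB phiL; rewrite leqNgt; apply/negP => lt.
case/negP: gP; apply/bigcupP; exists phi; last by rewrite inE.
by rewrite /fits phiB; apply/forall_inP.
Qed.

(** * Monochromatic directed cycles *)

(** Pairs point from [A] to [B]; for disjoint [A] and [B] no pair occurs reversed, as befits
    reference arcs for [reorient]. *)
Definition mono_pairs (V C : finType) (G : sgraph V) (A B : {set V})
    (chi : V -> C) : {set V * V} :=
  [set p | [&& p.1 \in A, p.2 \in B, edge G p.1 p.2 & chi p.1 == chi p.2]].

Lemma eq_mono_pairs (V C : finType) (G : sgraph V) (A B : {set V})
    (chi chi' : V -> C) :
  {in A, chi =1 chi'} -> {in B, chi =1 chi'} ->
  mono_pairs G A B chi = mono_pairs G A B chi'.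
Proof.
move=> eA eB; apply/setP=> -[a b]; rewrite !inE /=.
case: (boolP (a \in A)) => //= aA; case: (boolP (b \in B)) => //= bB.
by rewrite eA ?eB.
Qed.

Lemma mono_pairs_large (V C : finType) (G : sgraph V) (m : nat) (A B : {set V})
    (chi : V -> C) :
  (forall a, a \in A -> chi a \in frequent G B m chi a) ->
  m * #|A| <= #|mono_pairs G A B chi|.
Proof.
move=> hA; rewrite mulnC -sum_nat_const.
have -> : #|mono_pairs G A B chi| =
    \sum_(a in A) #|[set b in B | edge G a b && (chi b == chi a)]|.
  under [RHS]eq_bigr do rewrite -sum1_card.
  rewrite pair_big_dep -sum1_card; apply: eq_bigl => -[a b].
  by rewrite !inE [chi b == _]eq_sym.
by apply: leq_sum => a /hA; rewrite inE.
Qed.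

Definition restrict_to (V C : finType) (c0 : C) (A : {set V}) (chi : V -> C) :
  {ffun V -> C} := [ffun v => if v \in A then chi v else c0].

Lemma restrict_to_pffun (V C : finType) (c0 : C) (A : {set V}) (chi : V -> C) :
  restrict_to c0 A chi \in pffun_on c0 A predT.
Proof.
apply/pffun_onP; split=> // ; apply/supportP => v vA.
by rewrite ffunE (negPf vA).
Qed.

(** Two nested union bounds: over the colourings of [B], and for each of these over the colourings
    of the set [A phi] that it determines. *)
Lemma exists_cyclic_reorient (V C : finType) (G : sgraph V) (c0 : C) (l m : nat)
    (B : {set V}) (A : {ffun V -> C} -> {set V}) (L : V -> {set C}) :
    #|C| <= 2 ^ l -> 4 * l + 8 <= m -> 0 < #|B| ->
    (forall phi, [disjoint A phi & B]) ->
    (forall phi, phi \in pffun_on c0 B predT ->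
      (forall b, b \in B -> phi b \in L b) ->
      #|B| <= #|A phi| /\
      forall a, a \in A phi -> L a \subset frequent G B m phi a) ->
  exists w : {set V * V}, forall chi : V -> C, (forall v, chi v \in L v) ->
    exists2 S : {set V}, [disjoint S & B] &
      has_directed_cycle (reorient (mono_pairs G S B chi) w).
Proof.
move=> hl hm B0 disj hA.
pose col (phi psi : {ffun V -> C}) v := if v \in B then phi v else psi v.
pose bad phi psi := [set w |
  `[< ~ has_directed_cycle (reorient (mono_pairs G (A phi) B (col phi psi)) w) >]].
pose fits phi := (phi \in pffun_on c0 B predT) &&
  [forall b in B, phi b \in L b].
pose extends phi psi := (psi \in pffun_on c0 (A phi) predT) &&
  [forall a in A phi, psi a \in L a].
have card_on (D : {set V}) (P : pred {ffun V -> C}) :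
    #|[pred phi | (phi \in pffun_on c0 D predT) && P phi]| <= 2 ^ (l * #|D|).
  apply: (@leq_trans #|pffun_on c0 D predT|).
    by apply: subset_leq_card; apply/subsetP => phi /andP[].
  rewrite card_pffun_on expnM; case: #|D| => // n.
  by rewrite leq_exp2r.
pose Bad phi := \bigcup_(psi | extends phi psi) bad phi psi.
have leBad : #|\bigcup_(phi | fits phi) Bad phi| * 2 <= #|{set V * V}|.
  apply: (@union_bound _ _ _ _ (l * #|B|) 1); first exact: card_on.
  move=> phi /andP[phiB /forall_inP phiL]; have [leA LA] := hA phi phiB phiL.
  apply: (@union_bound _ _ _ _ (l * #|A phi|)); first exact: card_on.
  move=> psi /andP[psiA /forall_inP psiL].
  have notB v : v \in A phi -> v \in B = false.
    exact: disjointFr (disj phi).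
  apply: (@acyclic_reorient_rare _ _ (A phi :|: B)).
    move=> u v; rewrite !inE /= => /and4P[uA vB _ _].
    by rewrite uA vB orbT (notB u uA) andbF.
  have := @mono_pairs_large _ _ G m (A phi) B (col phi psi).
  have large a : a \in A phi -> col phi psi a \in frequent G B m (col phi psi) a.
    move=> aA; have := subsetP (LA a aA) _ (psiL a aA).
    have -> : col phi psi a = psi a by rewrite /col notB.
    rewrite !inE; congr (_ <= _); apply: eq_card => b.
    by rewrite !inE /col; case: (b \in B).
  move=> /(_ large); apply: leq_trans.
  (* The exponent to beat is x = l|A| + l|B| + 1. As 0 < |B| <= |A|, one has 3(|A| + |B|) + 2x <=
     (4l + 8)|A|, whence the bound on [m]. *)
  have := cardsUI (A phi) B; move: leA B0; set x := #|A phi|; set y := #|B|; nia.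
have [|w wP] := exists_notin_half _ leBad.
  by apply/card_gt0P; exists set0.
exists w => chi chiL; pose phi := restrict_to c0 B chi.
pose psi := restrict_to c0 (A phi) chi; exists (A phi) => //.
(* Otherwise [w] would be bad for the restrictions of [chi] to [B] and to [A phi]. *)
apply: contrapT => acyc; case/negP: wP; apply/bigcupP; exists phi.
  rewrite /fits restrict_to_pffun; apply/forall_inP => b bB.
  by rewrite ffunE bB.
apply/bigcupP; exists psi.
  rewrite /extends restrict_to_pffun; apply/forall_inP => b bA.
  by rewrite ffunE bA.
rewrite inE; apply/asboolP; rewrite (@eq_mono_pairs _ _ _ _ _ _ chi) // => v vS.
  by rewrite /col (disjointFr (disj phi) vS) ffunE vS.
by rewrite /col vS ffunE vS.
Qed.

(* Crossing edges follow [w], with reference direction towards [B]; the other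
   edges play no role and are oriented by the enumeration of [V]. *)
Definition crossing_arcs (V : finType) (G : sgraph V) (B : {set V})
    (w : {set V * V}) : {set V * V} :=
  [set p | edge G p.1 p.2 &&
    (if (p.1 \in B) == (p.2 \in B) then enum_rank p.1 < enum_rank p.2
     else if p.2 \in B then p \in w else (p.2, p.1) \notin w)].

Lemma exists_crossing_orientation (V : finType) (G : sgraph V) (B : {set V})
    (w : {set V * V}) :
  exists2 D : digraph V, is_orientation G D & arcs D = crossing_arcs G B w.
Proof.
have loopless : [forall v, (v, v) \notin crossing_arcs G B w].
  by apply/forallP => v; rewrite inE /= edge_irrefl.
have arcE u v : Defs.arc (Digraph loopless) u v = edge G u v &&
    (if (u \in B) == (v \in B) then enum_rank u < enum_rank v
     else if v \in B then (u, v) \in w else (v, u) \notin w).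
  by rewrite /Defs.arc inE.
exists (Digraph loopless) => //; apply/andP; split.
all: apply/forallP => u; apply/forallP => v; rewrite !arcE (edge_sym G v u).
all: case: (boolP (edge G u v)) => //= uv; rewrite [(v \in B) == _]eq_sym.
all: case: ifP => [_|].
- have : enum_rank u != enum_rank v.
    rewrite (inj_eq enum_rank_inj); apply: contraL uv => /eqP ->.
    by rewrite edge_irrefl.
  by rewrite -val_eqE /= neq_ltn => ->.
- by case: (u \in B); case: (v \in B) => //= _; rewrite ?orbN ?orNb.
- by rewrite negb_and -!leqNgt leq_total.
- by case: (u \in B); case: (v \in B) => //= _; rewrite ?andbN ?andNb.
Qed.

Lemma has_directed_cycle_mono (V C : finType) (e : rel V) (chi : V -> C)
    (D : digraph V) :
    (forall u v, e u v -> Defs.arc D u v /\ chi u = chi v) -> has_directed_cycle e ->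
  exists c, has_directed_cycle (induced D [set v | chi v == c]).
Proof.
move=> eP [[|x p] [// _ /andP[cyc uniqp]]]; exists (chi x), (x :: p); split=> //.
rewrite /ucycle uniqp andbT; move: cyc => /=.
suff gen y q : chi y = chi x -> path e y q ->
    path (induced D [set v | chi v == chi x]) y q by exact: gen.
elim: q y => //= z q IHq y yx /andP[/eP[Dyz yz] pathq].
rewrite /induced /= !inE yx -yz yx eqxx Dyz IHq //.
by rewrite -yz.
Qed.

(** * Numerical estimates *)

(** The quotient of the binomials is the product over i < k of (6k - i)/(3k - i), and each factor is
    at most 5/2. *)
Lemma bin_half_ratio (k : nat) :
  2 ^ k * 'C(2 * (3 * k), k) <= 5 ^ k * 'C(3 * k, k).
Proof.
rewrite -(leq_pmul2r (fact_gt0 k)) -!mulnA !bin_ffact !ffact_prod.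
have powE c : c ^ k = \prod_(i < k) c by rewrite prod_nat_const card_ord.
rewrite !powE -!big_split /=; apply: leq_prod => i _.
by have := ltn_ord i; lia.
Qed.

(** 1/T bounds from below the probability that a random list fits into a given half of the palette.
    The bound is on T^2 because the degree contains [T] twice, and (5/2)^2 <= 8. *)
Lemma exists_bin_ratio (k : nat) : exists T,
  [/\ 0 < T, 'C(2 * (3 * k), k) <= T * 'C(3 * k, k) & T ^ 2 <= 4 * 8 ^ k].
Proof.
set a := 'C(_, _); set b := 'C(3 * k, k); exists (a %/ b).+1.
have b0 : 0 < b by rewrite bin_gt0; lia.
split=> //; first by rewrite ltnW // -ltn_divLR.
set t := a %/ b; have t5 : 2 ^ k * t <= 5 ^ k.
  rewrite -(leq_pmul2r b0) -mulnA; apply: leq_trans (bin_half_ratio k).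
  by rewrite leq_mul2l leq_divM orbT.
have t8 : t ^ 2 <= 8 ^ k.
  have pos : 0 < 4 ^ k by rewrite expn_gt0.
  rewrite -(leq_pmul2l pos) -expnMn; apply: (@leq_trans (25 ^ k)).
    have -> : 4 ^ k * t ^ 2 = (2 ^ k * t) ^ 2.
      by rewrite expnMn -[(2 ^ k) ^ 2]expnM [k * 2]mulnC expnM.
    by rewrite (_ : 25 ^ k = (5 ^ k) ^ 2) ?leq_sqr // -expnM [k * 2]mulnC expnM.
  by case: (k) => // n; rewrite leq_exp2r.
have pos : 0 < 8 ^ k by rewrite expn_gt0.
move: t8 pos; rewrite !expnS !expn0; move: (8 ^ k) => e; nia.
Qed.

(** The left side is twice the minimum degree [d] of the final construction; T^2 supplies 8^k and
    the rest is cubic in [k]. *)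
Lemma degree_budget (k T : nat) : 0 < k -> T ^ 2 <= 4 * 8 ^ k ->
  2 * (2 * (8 * T * (3 * k + 2) * T) *
    (3 * k * (4 * (3 * k) + 8) + (2 * (3 * k) + 3)))
  <= k.+1 ^ 7 * 2 ^ (3 * k.+1 + 17).
Proof.
(* Four of the seven factors k + 1 are weakened to 2. *)
move=> k0 T8; apply: (@leq_trans (k.+1 ^ 3 * 2 ^ 4 * (8 ^ k * 2 ^ 12))); last first.
  apply: leq_mul.
    rewrite (expnD _ 3 4) leq_mul2l; apply/orP; right.
    by rewrite leq_exp2r.
  rewrite (_ : 3 * k.+1 + 17 = 3 * k + (12 + 8)); last by lia.
  rewrite expnD expnM leq_mul2l; apply/orP; right.
  by rewrite leq_pexp2l.
have poly : (3 * k + 2) * (36 * k ^ 2 + 30 * k + 3) <= 108 * k.+1 ^ 3.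
  rewrite !expnS !expn0; clear; nia.
apply: (@leq_trans (32 * T ^ 2 * (108 * k.+1 ^ 3))).
  apply: leq_trans (leq_mul (leqnn _) poly).
  rewrite !expnS !expn0; clear; lia.
apply: (@leq_trans (32 * (4 * 8 ^ k) * (108 * k.+1 ^ 3))).
  by rewrite leq_mul2r leq_mul2l T8 !orbT.
move: (8 ^ k) (k.+1 ^ 3) => e f; rewrite (_ : 12 = 6 + 6) // (expnD 2 6 6).
rewrite -[2 ^ 6]/64 -[2 ^ 4]/16; nia.
Qed.

(** * Choice of parameters and conclusion *)

Lemma exists_not_dichoosable (V : finType) (G : sgraph V) (k : nat) :
    0 < k -> 0 < #|V| ->
    k.+1 ^ 7 * 2 ^ (3 * k.+1 + 17) * #|V| <= \sum_(v : V) degree G v ->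
  exists2 D : digraph V, is_orientation G D & ~ dichoosable D k.
Proof.
move=> k0 V0 hdeg; have [T [T0 hT T8]] := exists_bin_ratio k.
(* [l] and [h] have the same value but different roles: 2^l bounds the number of colours, [h] is
   half of it. [m] is dictated by the cycles, [N] by the lists outside [B], and [d] by the sampling
   of [B]. *)
pose l := 3 * k; pose h := 3 * k; pose m := 4 * l + 8; pose C := 'I_(2 * h).
pose N := 8 * T * (l + 2); pose d := 2 * (N * T) * (h * m + (2 * h + 3)).
have cardC : #|C| = 2 * h by rewrite card_ord.
have kh : k <= h by rewrite /h; lia.
have c0 : C by apply: (@Ordinal _ 0); rewrite /h; lia.
have hm0 : 0 < h * m by rewrite /h /m; nia.
have N0 : 0 < N by rewrite /N; nia.
have Cl : #|C| <= 2 ^ l.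
  rewrite cardC /h /l expnM.
    case: k k0 {hdeg hT T8 l h m C N d cardC kh c0 hm0 N0} => // n _.
  by elim: n => // n IHn; rewrite expnS; lia.
have [|U U0 degU] := @min_degree_subset _ G d V0.
  apply: leq_trans hdeg; rewrite leq_mul2r; apply/orP; right.
  exact: degree_budget.
have [B [L1 [BU le]]] := exists_rich_sample cardC T0 N0 kh hT degU.
pose S := [set v in U | rich G h (h * m) B L1 v] :\: B.
have leS : #|U| <= #|S| + #|[set v in U | ~~ rich G h (h * m) B L1 v]| + #|B|.
  set Y := [set v in U | ~~ _].
  have sub : U \subset (S :|: Y) :|: B.
    apply/subsetP => v vU; rewrite !inE vU /=.
    by case: (v \in B); case: rich.
  apply: leq_trans (subset_leq_card sub) _; apply: leq_trans (leq_card_setU _ _) _.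
  by rewrite leq_add2r leq_card_setU.
have posU : 0 < #|U| by rewrite card_gt0.
have N8 : 8 <= N by rewrite /N; nia.
(* As N >= 8, the poor vertices and [B] fill at most a quarter of [U], so |S| >= 3|U|/4. *)
have leB : N * #|B| <= 4 * #|S| by move: leS le; nia.
have S0 : 0 < #|S| by move: leS le; nia.
have richS v : v \in S -> rich G h (h * m) B L1 v by rewrite !inE => /and3P[].
have B0 : 0 < #|B|.
  have /card_gt0P[v /richS /forallP richv] := S0.
  have [|Q _ Qh] := @exists_subset_card _ [set: C] h.
    by rewrite cardsT cardC; lia.
  have /implyP := richv Q; rewrite Qh eqxx => /(_ isT) leQ.
  apply: leq_trans hm0 _; apply: leq_trans leQ _; apply: subset_leq_card.
  by apply/subsetP => b; rewrite inE => /andP[].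
have [|g gP] := exists_frequent_lists (S := S) c0 T0 kh cardC hT Cl hm0 richS.
  (* [N] is 4 * 2T(l + 2), and (l + 1)|B| + 1 <= (l + 2)|B| because [B] is non-empty. *)
  rewrite -(@leq_pmul2l 4) //; apply: leq_trans leB.
  rewrite (_ : N * #|B| = 4 * (2 * T * ((l + 2) * #|B|))); last by rewrite /N; lia.
  by rewrite !leq_pmul2l ?muln_gt0 ?T0 // mulnDl; lia.
pose L v : draw C k := if v \in B then L1 v else g v.
pose A (phi : {ffun V -> C}) := [set a in S | val (g a) \subset frequent G B m phi a].
have SB v : v \in S -> v \in B = false by rewrite !inE => /andP[/negbTE].
have disj phi : [disjoint A phi & B].
  rewrite disjoint_subset; apply/subsetP => v; rewrite inE => /andP[/SB vB _].
  by rewrite inE /= vB.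
have [||w wP] := @exists_cyclic_reorient _ _ G c0 l m B A
  (fun v => val (L v)) Cl _ B0 disj.
- by [].
- move=> phi phiB phiL; split.
    by apply: gP => // b bB; have := phiL b bB; rewrite /L bB.
  move=> a; rewrite inE => /andP[aS]; by rewrite /L SB.
have [D oD DE] := exists_crossing_orientation G B w; exists D => // chD.
(* Palette colours start at 0 while list colours must be positive, hence the shift by one. *)
pose LL v : {fset nat} := [fset (nat_of_ord c).+1 | c in val (L v)]%fset.
have [|phi [phiL acyc]] := chD LL.
  move=> v; split=> [|c /imfsetP[c' _ ->] //].
  rewrite card_imfset; last by move=> x y [/val_inj].
  by rewrite -cardE (eqP (valP (L v))).
have [chi chiP] : {chi : V -> C &
    forall v, chi v \in val (L v) /\ phi v = (chi v).+1}.
  apply: (@boolp.choice _ _ (fun v (c : C) => c \in val (L v) /\ phi v = c.+1)) => v.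
  by have /imfsetP[c /= cL ->] := phiL v; exists c.
have [|Z disjZ cyc] := wP chi; first by move=> v; case: (chiP v).
have [|c [p [p0 cycp]]] := @has_directed_cycle_mono _ _ _ chi D _ cyc.
  move=> u v; have notB z : z \in Z -> z \in B = false by exact: disjointFr.
  rewrite /reorient !inE /= /Defs.arc DE inE /=.
  case/orP => [/andP[/and4P[uZ vB -> /eqP ->] uvw]
    |/andP[vuw /and4P[vZ uB vu /eqP ->]]].
    by rewrite (notB u) // vB.
  by rewrite edge_sym vu (notB v) // uB /=; split.
apply: (acyc c.+1); exists p; split=> //.
suff -> : [set v | phi v == c.+1] = [set v | chi v == c] by [].
by apply/setP => v; rewrite !inE; have [_ ->] := chiP v.
Qed.


Theorem theorem3p3 :
  exists r0 : nat, forall r : nat, (r0 <= r)%N ->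
    forall (V : finType) (G : sgraph V),
      ((r ^ 7 * 2 ^ (3 * r + 17))%N%:R <= average_degree G)%R ->
      (r <= graph_dichoosability G)%N.
Proof.
(* Starting at 2 makes k = r - 1 positive. *)
exists 2 => -[|k] // k0 V G hAd.
have [V0|V0] := posnP #|V|.
  (* Without vertices the average degree is 0 by convention, below the positive bound. *)
  move: hAd; rewrite /average_degree V0 GRing.invr0 GRing.mulr0.
  rewrite (Num.Theory.ler_nat _ _ 0) leqn0 muln_eq0 !expn_eq0 /=.
  by [].
have hdeg : k.+1 ^ 7 * 2 ^ (3 * k.+1 + 17) * #|V| <= \sum_(v : V) degree G v.
  move: hAd; rewrite /average_degree Num.Theory.ler_pdivlMr ?Num.Theory.ltr0n //.
  by rewrite -GRing.natrM Num.Theory.ler_nat.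
have [|D oD nch] := exists_not_dichoosable _ V0 hdeg; first by [].
apply: (@leq_trans (dichoosability D)); last exact: leq_bigmax_cond.
(* If the minimum [n] were at most [k], lists of size at least [k] would also have size at least
   [n]. *)
rewrite /dichoosability; case: ex_minnP => n /asboolP chn _.
rewrite ltnNge; apply/negP => nk; apply: nch => L hL; apply: chn => v.
by have [kL Lpos] := hL v; split=> //; apply: leq_trans kL.
Qed.
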